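(* Let $0 < a < \frac14$, set $L_a = [-2a,2a]^2 \setminus [-a,a]^2$, and let $0 < \delta < \frac12 \min\{1-4a, a\}$. Define $h_{(L_a;\delta,\frac{\delta}{2})} : \mathbb{R}^2 \to \mathbb{R}$ by $$h_{(L_a;\delta,\frac{\delta}{2})}(x,y) = f_{([-2a,2a];\delta,\delta)}(x)\, f_{([-2a,2a];\delta,\delta)}(y) - f_{([-a,a];\frac{\delta}{2},\frac{\delta}{2})}(x)\, f_{([-a,a];\frac{\delta}{2},\frac{\delta}{2})}(y).$$ Then it is not the case that $\sum_{n\in\mathbb{Z}} h_{(L_a;\delta,\frac{\delta}{2})}^2(2^n x, 2^n y) = 1$ for almost every $(x,y) \in \mathbb{R}^2$.
   Context: Fix a function $\theta \in C^\infty(\mathbb{R})$, real-valued, with $\theta(x)=0$ for $x\le -1$, $\theta(x)=1$ for $x \ge 1$, and $\theta(x)^2+\theta(-x)^2=1$ for all $x\in\mathbb{R}$ (such functions exist). For a closed interval $I=[c,d]$ and $\delta_1,\delta_2>0$ with $\delta_1+\delta_2\le d-c$, define $f_{(I;\delta_1,\delta_2)}:\mathbb{R}\to\mathbb{R}$ by $$f_{(I;\delta_1,\delta_2)}(x)=\begin{cases}\theta\left(\frac{x-c}{\delta_1}\right) & x<c+\delta_1,\\ 1 & c+\delta_1\le x\le d-\delta_2,\\ \theta\left(\frac{d-x}{\delta_2}\right) & x>d-\delta_2.\end{cases}$$ *)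

(* Defs.v *)
From HB Require Import structures.
From mathcomp Require Import all_boot all_order all_algebra.
From mathcomp Require Import all_classical all_reals all_analysis.

Set Implicit Arguments.
Unset Strict Implicit.
Unset Printing Implicit Defensive.

Import Order.TTheory GRing.Theory Num.Theory.
Import numFieldNormedType.Exports.

Local Open Scope classical_set_scope.
Local Open Scope ring_scope.

Definition smooth (R : realType) (f : R -> R) : Prop :=
  forall (n : nat) (x : R), derivable (derive1n n f) x 1.

(* f_([c, d]; d1, d2); meaningful when 0 < d1, 0 < d2 and d1 + d2 <= d - c. *)
Definition fI (R : realType) (theta : R -> R) (c d d1 d2 x : R) : R :=
  if x < c + d1 then theta ((x - c) / d1)
  else if x <= d - d2 then 1
  else theta ((d - x) / d2).

(* h_(L_a; delta, delta / 2) with L_a = [-2a, 2a]^2 \ [-a, a]^2; the set L_a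
   enters only through a. *)
Definition hL (R : realType) (theta : R -> R) (a delta x y : R) : R :=
  fI theta (- (2 * a)) (2 * a) delta delta x *
  fI theta (- (2 * a)) (2 * a) delta delta y -
  fI theta (- a) a (delta / 2) (delta / 2) x *
  fI theta (- a) a (delta / 2) (delta / 2) y.

(* Main.v *)
Require Import Defs.
From mathcomp Require Import all_boot all_order all_algebra.
From mathcomp Require Import all_classical all_reals all_analysis.
From mathcomp Require Import lra zify ring.
Import Order.TTheory GRing.Theory Num.Theory.
Import numFieldNormedType.Exports.
Local Open Scope classical_set_scope.
Local Open Scope ring_scope.

(** Write [F] for the outer cutoff [f_([-2a, 2a]; delta, delta)].  The inner
    cutoff is [x |-> F (2 x)], so with [H (x, y) = F x * F y] the [n]-th term of
    the sum is the square of [H (2^n z) - H (2^(n+1) z)].  For [z] other than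
    the origin these differences telescope to 1, but their squares need not sum
    to 1: when [0 < x < a] and [y] is in the transition zone
    [[2a, 2a + delta[], only the terms [n = 0] and [n = -1] survive, with
    values [t ^+ 2] and [(1 - t) ^+ 2] where [t = theta ((2a - y) / delta)]
    ([esum_hL_sqr]).  Their sum is 1 only if [t] is 0 or 1.  Now
    [theta 0 ^+ 2 = 1 / 2], so by continuity [t] avoids 0 and 1 for [y] close
    to [2a] ([theta_avoids_01]).  Hence the identity fails on a whole open
    rectangle, which is not negligible ([open_rectangle_not_negligible]). *)

Section Cutoff.
Variables (R : realType) (theta : R -> R).
Hypothesis theta0 : forall x : R, x <= -1 -> theta x = 0.
Hypothesis theta1 : forall x : R, 1 <= x -> theta x = 1.

Lemma fI_plateau (c d x : R) : 0 < d -> - c + d <= x -> x <= c - d ->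
  fI theta (- c) c d d x = 1.
Proof. by move=> d0 cx xc; rewrite /fI ltNge cx /= xc. Qed.

Lemma fI_right_tail (c d x : R) : 0 < d -> d <= c -> c + d <= x ->
  fI theta (- c) c d d x = 0.
Proof.
move=> d0 dc cx; rewrite /fI ifF; last by apply/negbTE; rewrite -leNgt; lra.
rewrite ifF; last by apply/negbTE; rewrite -ltNge; lra.
by apply: theta0; rewrite ler_pdivrMr//; lra.
Qed.

(** The middle branch agrees with the right one at the junction point
    [c - d], so the right branch is valid there too. *)
Lemma fI_right_transition (c d x : R) : 0 < d -> d <= c -> c - d <= x ->
  fI theta (- c) c d d x = theta ((c - x) / d).
Proof.
move=> d0 dc cx; rewrite /fI ifF; last by apply/negbTE; rewrite -leNgt; lra.
case: ifPn => // xc; rewrite theta1// ler_pdivlMr//; lra.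
Qed.

(** For [n > 0] the ordinate [2^n y] is beyond the support of both cutoffs. *)
Lemma hL_sqr_pos (a delta x y : R) (n : int) :
  0 < delta -> 2 * delta < a -> 2 * a <= y -> 0 < n ->
  hL theta a delta ((2 : R) ^ n * x) ((2 : R) ^ n * y) ^+ 2 = 0.
Proof.
move=> d0 da ay n0.
have n2 : 2 <= (2 : R) ^ n.
  by rewrite -[leLHS]expr1z ler_eXz2l // ltr1n.
have big : 4 * a <= 2 ^ n * y by nra.
rewrite /hL (fI_right_tail (2 * a) _ (2 ^ n * y)); [|lra..].
rewrite (fI_right_tail a _ (2 ^ n * y)); [|lra..].
by rewrite !mulr0 subrr expr0n.
Qed.

(** For [n < -1] both coordinates lie on the plateau of both cutoffs. *)
Lemma hL_sqr_lt_N1 (a delta x y : R) (n : int) :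
  0 < delta -> 2 * delta < a -> 0 < x < a -> 2 * a <= y < 2 * a + delta ->
  n < -1 ->
  hL theta a delta ((2 : R) ^ n * x) ((2 : R) ^ n * y) ^+ 2 = 0.
Proof.
move=> d0 da /andP[x0 xa] /andP[ay ya] nN1.
have n4 : (2 : R) ^ n <= 4^-1.
  have -> : (4^-1 : R) = 2 ^ (-2 : int).
    by rewrite -[_ ^ _]/((2 ^+ 2)^-1); lra.
  by rewrite ler_eXz2l ?ltr1n//; lia.
have n0 : 0 < (2 : R) ^ n by rewrite exprz_gt0.
rewrite /hL !fI_plateau ?subrr ?expr0n//; nra.
Qed.

(** The scale [n = 0]: [y] has left the support of the inner cutoff. *)
Lemma hL_strip (a delta x y : R) :
  0 < delta -> 2 * delta < a -> 0 < x < a -> 2 * a <= y < 2 * a + delta ->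
  hL theta a delta x y = theta ((2 * a - y) / delta).
Proof.
move=> d0 da /andP[x0 xa] /andP[ay ya].
rewrite /hL (fI_plateau (2 * a) _ x) ?mul1r; [|lra..].
rewrite (fI_right_tail a _ y) ?mulr0 ?subr0; [|lra..].
by rewrite fI_right_transition//; lra.
Qed.

(** The scale [n = -1]: both coordinates lie on the outer plateau, and [y / 2]
    crosses the edge of the inner cutoff exactly as [y] crosses the outer one. *)
Lemma hL_half_strip (a delta x y : R) :
  0 < delta -> 2 * delta < a -> 0 < x < a -> 2 * a <= y < 2 * a + delta ->
  hL theta a delta (2^-1 * x) (2^-1 * y) = 1 - theta ((2 * a - y) / delta).
Proof.
move=> d0 da /andP[x0 xa] /andP[ay ya].
rewrite /hL (fI_plateau (2 * a) _ (_ * x)); [|lra..].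
rewrite (fI_plateau (2 * a) _ (_ * y)); [|lra..].
rewrite (fI_plateau a _ (_ * x)); [|lra..].
rewrite fI_right_transition ?mul1r; [|lra..].
congr (1 - theta _).
by field; rewrite gt_eqF.
Qed.

Lemma esum_hL_sqr (a delta x y : R) :
  0 < delta -> 2 * delta < a -> 0 < x < a -> 2 * a <= y < 2 * a + delta ->
  let t := theta ((2 * a - y) / delta) in
  \esum_(n in [set: int])
    ((hL theta a delta ((2 : R) ^ n * x) ((2 : R) ^ n * y)) ^+ 2)%:E
  = (t ^+ 2 + (1 - t) ^+ 2)%:E.
Proof.
move=> d0 da xa ya t.
pose A : set int := [set 0; -1].
rewrite (_ : \esum_(n in _) _ = \esum_(n in A)
    ((hL theta a delta ((2 : R) ^ n * x) ((2 : R) ^ n * y)) ^+ 2)%:E); last first.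
  rewrite [RHS]esum_mkcond; apply: eq_esum => n _; case: ifPn => // nA.
  have [n0 nN1] : n != 0 /\ n != -1.
    by split; apply: contraNN nA => /eqP ->; rewrite inE; [left|right].
  have [n_gt0|n_le0] := ltP 0 n; first by rewrite hL_sqr_pos//; case/andP: ya.
  by rewrite hL_sqr_lt_N1//; lia.
rewrite esum_fset; last 2 first.
- exact: finite_set2.
- by move=> n _; rewrite lee_fin sqr_ge0.
rewrite /A fsbigU0 ?fsbig_set1//; last by move=> n [-> ].
by rewrite expr0z !mul1r exprN1 hL_strip// hL_half_strip// -EFinD.
Qed.

End Cutoff.

Lemma theta_avoids_01 (R : realType) (theta : R -> R) :
  {for 0, continuous theta} ->
  (forall x : R, theta x ^+ 2 + theta (- x) ^+ 2 = 1) ->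
  exists2 e : R, 0 < e &
    forall s : R, `|s| < e -> theta s * (1 - theta s) != 0.
Proof.
move=> ct theta_sqr.
have t0 := theta_sqr 0; rewrite oppr0 in t0.
(* At 0 the hypothesis reads 2 (theta 0)^2 = 1. *)
have g0 : theta 0 * (1 - theta 0) != 0.
  by apply/eqP => g0; nra.
have cg : theta s * (1 - theta s) @[s --> (0 : R)] --> theta 0 * (1 - theta 0).
  by apply: cvgM => //; apply: cvgB => //; exact: cvg_cst.
have /nbhs_ballP[e e0 he] :
    \forall s \near (0 : R), theta s * (1 - theta s) != 0.
  exact: cvgr_neq0 cg g0.
exists e => // s se; apply: he.
by rewrite /ball /= sub0r normrN.
Qed.

Lemma open_rectangle_not_negligible (R : realType) (p q r s : R) :
  p < q -> r < s ->
  ~ (lebesgue_measure \x lebesgue_measure)%E.-negligible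
      (`]p, q[%classic `*` `]r, s[%classic : set (R * R)).
Proof.
move=> pq rs.
have mI (u v : R) : measurable `]u, v[%classic by exact: measurable_itv.
move=> /negligibleP N0; have {}N0 := N0 (measurableX (mI p q) (mI r s)).
have : (@lebesgue_measure R `]p, q[ * @lebesgue_measure R `]r, s[ = 0)%E.
  by rewrite -N0; apply/esym/product_measure1E.
rewrite !lebesgue_measure_itv/= !lte_fin pq rs -!EFinD -EFinM => -[] /eqP.
by rewrite mulf_eq0 !subr_eq0 !gt_eqF.
Qed.

Theorem proposition14 (R : realType) (theta : R -> R)
    (theta_smooth : smooth theta)
    (theta0 : forall x : R, x <= -1 -> theta x = 0)
    (theta1 : forall x : R, 1 <= x -> theta x = 1)
    (theta_sqr : forall x : R, theta x ^+ 2 + theta (- x) ^+ 2 = 1)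
    (a : R) (a_gt0 : 0 < a) (a_lt : a < 4^-1)
    (delta : R) (delta_gt0 : 0 < delta)
    (delta_lt : delta < 2^-1 * Num.min (1 - 4 * a) a) :
  ~ {ae (@lebesgue_measure R \x @lebesgue_measure R)%E, forall z : R * R,
      \esum_(n in [set: int])
        ((hL theta a delta ((2 : R) ^ n * z.1) ((2 : R) ^ n * z.2)) ^+ 2)%:E
      = 1%:E}.
Proof.
have da : 2 * delta < a.
  have : Num.min (1 - 4 * a) a <= a by rewrite ge_min lexx orbT.
  lra.
have ct : {for 0, continuous theta}.
  apply: differentiable_continuous; apply/derivable1_diffP.
  exact: theta_smooth 0%N 0.
have [e e0 he] := theta_avoids_01 _ _ ct theta_sqr.
(* The cap by 1 keeps the strip of width [eps * delta] in the transition
   zone, where [esum_hL_sqr] applies. *)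
pose eps := Num.min e 1.
have eps0 : 0 < eps by rewrite lt_min e0 ltr01.
have epse : eps <= e by rewrite ge_min lexx.
have eps1 : eps <= 1 by rewrite ge_min lexx orbT.
have ed0 : 0 < eps * delta by rewrite mulr_gt0.
have ed1 : eps * delta <= delta by nra.
apply: contra_not (open_rectangle_not_negligible _ 0 a (2 * a)
  (2 * a + eps * delta) a_gt0 _); last by lra.
apply: negligibleS => -[x y] [/=]; rewrite !in_itv/= => xa /andP[ay ya].
rewrite esum_hL_sqr//; last by apply/andP; split; lra.
have := he ((2 * a - y) / delta); set t := theta _ => ht.
have /ht/eqP tN01 : `|(2 * a - y) / delta| < e.
  rewrite normrM normfV (gtr0_norm delta_gt0) ltr_pdivrMr// distrC gtr0_norm; nra.
by move=> [tt]; apply: tN01; lra.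
Qed.
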